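(* Let $(A_n)_{n\ge 1}$ be a sequence of random matrices defined on a common probability space, where $A_n=(\xi_{i,j})_{1\le i,j\le n}$ is an $n\times n$ matrix whose entries are strictly positive and identically distributed as a random variable $\xi$ (whose distribution does not depend on $n$). Assume that one of the following holds: I) for each $n$, the entries $(\xi_{i,j})_{1\le i,j\le n}$ of $A_n$ are independent; or II) for each $n$, $A_n$ is symmetric ($\xi_{i,j}=\xi_{j,i}$) and the entries $(\xi_{i,j})_{1\le i\le j\le n}$ are independent. Assume that for some $\beta>0$ $$\lim_{t\to\infty}\frac{\log\mathbb{P}(\xi\ge t)}{\log t}=-\frac1\beta .$$ Then almost surely $$\lim_{n\to\infty}\frac{\log \operatorname{per} A_n}{n\log n}=\max(1,\beta).$$
   Context: The permanent of an $n\times n$ matrix $A=(a_{i,j})$ is $\operatorname{per}A=\sum_{\pi\in S_n}\prod_{i=1}^n a_{i,\pi(i)}$, where $S_n$ is the set of permutations of $\{1,\dots,n\}$. The entries of $A_n$ may depend on $n$ (this is suppressed in the notation), and no assumption is made on the joint distribution of the matrices $A_n$ for different values of $n$. *)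

(* Defs.v *)
From mathcomp Require Import all_boot all_order all_algebra all_fingroup.
From mathcomp Require Import all_classical all_reals all_analysis.

Set Implicit Arguments.
Unset Strict Implicit.
Unset Printing Implicit Defensive.

Import Order.TTheory GRing.Theory Num.Theory.
Import numFieldNormedType.Exports.

Local Open Scope classical_set_scope.
Local Open Scope ring_scope.

Definition permanent (R : comPzRingType) (n : nat) (M : 'M[R]_n) : R :=
  \sum_(s : 'S_n) \prod_(i < n) M i (s i).

Section RandomVariables.
Context d (Omega : measurableType d) (R : realType) (P : probability Omega R).

Definition realization (n : nat) (A : 'M[{RV P >-> R}]_n) (w : Omega) : 'M[R]_n :=
  \matrix_(i, j) A i j w.

(* Mutual independence of the random variables [X i] for [i] in [D] only. *)
Definition independent_RVs (I : finType) (D : {set I}) (X : I -> {RV P >-> R}) :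
    Prop :=
  forall (J : {set I}) (B : I -> set R), J \subset D ->
    (forall i, measurable (B i)) ->
    P (\bigcap_(i in [set` J]) (X i @^-1` B i)) =
    (\prod_(i in J) P (X i @^-1` B i))%E.

Definition independent_entries (n : nat) (A : 'M[{RV P >-> R}]_n) : Prop :=
  @independent_RVs ('I_n * 'I_n)%type [set: 'I_n * 'I_n]%SET (fun p => A p.1 p.2).

Definition independent_upper_entries (n : nat) (A : 'M[{RV P >-> R}]_n) : Prop :=
  @independent_RVs ('I_n * 'I_n)%type [set p : 'I_n * 'I_n | (p.1 <= p.2)%N]%SET
    (fun p => A p.1 p.2).

Definition as_symmetric (n : nat) (A : 'M[{RV P >-> R}]_n) : Prop :=
  forall i j : 'I_n, {ae P, forall w, A i j w = A j i w}.

Definition as_positive (X : {RV P >-> R}) : Prop := {ae P, forall w, 0 < X w}.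

End RandomVariables.

(* [X] and [Y] may live on different probability spaces. *)
Definition identically_distributed (R : realType)
    d (Omega : measurableType d) (P : probability Omega R)
    d' (Omega' : measurableType d') (P' : probability Omega' R)
    (X : {RV P >-> R}) (Y : {RV P' >-> R}) : Prop :=
  forall B : set R, measurable B -> distribution P X B = distribution P' Y B.

(* Main.v *)
(** Idea. Upper bound: [per A <= prod_i sum_j a_ij <= N^n prod_ij (1 + a_ij / N)],
    and for [N = n^nu] with [nu] slightly above [max 1 beta] the last product is
    [exp (O(n))] off an event of summable probability: raised to a power [p < 1 / beta], [p <= 1],
    each factor has expectation [1 + O(1 / n)], and in the symmetric case the
    product is at most the square of the product over the independent entries.

    Lower bound: if every block [S x T] with [|S| + |T| = K + 1] contains an entry
    [>= t], then expanding along rows down to size [K] and applying Hall's theorem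
    give [per A >= t^n (n - K)!].  Taking [t] constant and [K] a small proportion of
    [n] yields the rate [1]; taking [t = n^s] with [s < beta] and [K = n] yields the
    rate [s].  In both cases the event fails with summable probability by a
    union bound over blocks, where symmetry only halves the number of independent
    entries. *)

Require Import Defs.
From mathcomp Require Import all_boot all_order all_algebra all_fingroup.
From mathcomp Require Import all_classical all_reals all_analysis.
From mathcomp Require Import measurable_realfun.
From mathcomp Require Import zify ring lra.

Set Implicit Arguments.
Unset Strict Implicit.
Unset Printing Implicit Defensive.

Import Order.TTheory GRing.Theory Num.Theory.
Import numFieldNormedType.Exports.

Local Open Scope classical_set_scope.
Local Open Scope ring_scope.

(** * Hall's theorem and bounds on permanents *)

Lemma Hall_marriage (I J : finType) (N : I -> {set J}) :
  (forall S : {set I}, (#|S| <= #|(\bigcup_(i in S) N i)%SET|)%N) ->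
  exists2 f : I -> J, injective f & forall i, f i \in N i.
Proof.
(* Rado's argument: if two elements of [N a] could not be removed, submodularity
   of [S |-> #|N(S)|] would contradict Hall's condition, so we may shrink every
   [N a] to a singleton. *)
have [m] := ubnP (\sum_i #|N i|)%N; elim: m N => // m IH N ltm hall.
have [/existsP[a /card_gt1P[x1 [x2 [x1a x2a x12]]]]|] :=
    boolP [exists a, (1 < #|N a|)%N].
- pose N' x i := if i == a then (N a :\ x)%SET else N i.
  have N'sub x i : N' x i \subset N i.
    by rewrite /N'; case: eqP => // ->; exact: subD1set.
  have reduce x : x \in N a ->
      (forall S : {set I}, (#|S| <= #|(\bigcup_(i in S) N' x i)%SET|)%N) ->
      exists2 f : I -> J, injective f & forall i, f i \in N i.
    move=> xa hall'; case: (IH (N' x)) => //.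
      rewrite -ltnS (leq_trans _ ltm)// ltnS (bigD1 a)//= [ltnRHS](bigD1 a)//=.
      rewrite -addSn leq_add//.
        by rewrite /N' eqxx [leqRHS](cardsD1 x) xa.
      by apply: leq_sum => i ia; exact/subset_leq_card/N'sub.
    by move=> f finj fN; exists f => // i; exact/(fintype.subsetP (N'sub x i))/fN.
  have [/forallP h1|] := boolP [forall S : {set I},
      #|S| <= #|(\bigcup_(i in S) N' x1 i)%SET|]%N; first exact: (reduce x1).
  have [/forallP h2|] := boolP [forall S : {set I},
      #|S| <= #|(\bigcup_(i in S) N' x2 i)%SET|]%N; first by move=> _; exact: (reduce x2).
  move=> /forallPn[S2]; rewrite -ltnNge => lt2 /forallPn[S1]; rewrite -ltnNge => lt1.
  have inS x (S : {set I}) : (#|(\bigcup_(i in S) N' x i)%SET| < #|S|)%N -> a \in S.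
    apply: contraLR => aS; rewrite -leqNgt (leq_trans (hall S))//.
    apply/subset_leq_card/bigcupsP => i iS; apply/(fintype.subset_trans _ (finset.bigcup_sup i iS)).
    by rewrite /N'; case: eqP iS => // ->; rewrite (negbTE aS).
  set U1 := (\bigcup_(i in S1) N' x1 i)%SET in lt1 *.
  set U2 := (\bigcup_(i in S2) N' x2 i)%SET in lt2 *.
  (* No element of [N a] equals both [x1] and [x2], so each survives in [U1] or in [U2]; by [inS],
     both [S1] and [S2] contain [a]. *)
  have hU : (#|S1 :|: S2| <= #|U1 :|: U2|)%N.
    apply: leq_trans (hall _) (subset_leq_card _); apply/fintype.subsetP => y /bigcupP[i iS yi].
    have [ia|ia] := eqVneq i a.
      rewrite inE; have [yx1|yx1] := eqVneq y x1.
        apply/orP; right; apply/bigcupP; exists a; first exact: inS lt2.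
        by rewrite /N' eqxx !inE -ia yi yx1 andbT.
      apply/orP; left; apply/bigcupP; exists a; first exact: inS lt1.
      by rewrite /N' eqxx !inE -ia yi yx1.
    move: iS; rewrite inE => /orP[iS|iS]; rewrite inE; apply/orP; [left|right];
      by apply/bigcupP; exists i => //; rewrite /N' (negbTE ia).
  have hI : (#|(S1 :&: S2) :\ a| <= #|U1 :&: U2|)%N.
    apply: leq_trans (hall _) (subset_leq_card _); apply/fintype.subsetP => y /bigcupP[i].
    rewrite !inE => /and3P[ia i1 i2] yi.
    by apply/andP; split; apply/bigcupP; exists i => //; rewrite /N' (negbTE ia).
  have aI : a \in S1 :&: S2 by rewrite inE (inS _ _ lt1) (inS _ _ lt2).
  (* Adding [hU] and [hI] gives [#|U1| + #|U2| >= #|S1| + #|S2| - 1], whereas [lt1] and [lt2] allow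
     at most [#|S1| + #|S2| - 2]. *)
  have := cardsUI S1 S2; have := cardsUI U1 U2; have := cardsD1 a (S1 :&: S2).
  rewrite aI; lia.
- rewrite negb_exists => /forallP N1.
  have Ngt0 i : (0 < #|N i|)%N by rewrite -(cards1 i) (leq_trans (hall _))// big_set1.
  have NE i : exists x, N i == [set x]%SET.
    have /cards1P[x ->] : #|N i| == 1%N by rewrite eqn_leq Ngt0 andbT leqNgt N1.
    by exists x.
  pose f i := xchoose (NE i); have fE i : N i = [set f i]%SET by exact/eqP/(xchooseP (NE i)).
  exists f => [i j fij|i]; last by rewrite fE inE.
  apply/eqP; apply/negP => /negP ij; have := hall [set i; j]%SET.
  by rewrite finset.bigcup_setU !big_set1 cards2 ij !fE fij finset.setUid cards1.
Qed.

Lemma permanent_row0 (R : comPzRingType) (n : nat) (M : 'M[R]_n.+1) :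
  permanent M = \sum_j M ord0 j * permanent (row' ord0 (col' j M)).
Proof.
pose h (p : 'I_n.+1 * 'S_n) := lift_perm ord0 p.1 p.2.
have hinj : injective h.
  move=> [j s] [k t] /permP e; have jk : j = k.
    by have := e ord0; rewrite !lift_perm_id.
  rewrite -{k}jk in e *; congr (_, _); apply/permP => i.
  by have := e (lift ord0 i); rewrite !lift_perm_lift => /lift_inj.
have hbij : bijective h.
  apply: inj_card_bij => //.
  by rewrite card_prod !card_Sn card_ord factS.
rewrite /permanent (reindex h) /=; last exact: onW_bij.
under [RHS]eq_bigr do rewrite big_distrr /=.
rewrite pair_big /=; apply: eq_bigr => -[j s] _ /=.
rewrite big_ord_recl lift_perm_id; congr (_ * _); apply: eq_bigr => i _.
by rewrite lift_perm_lift !mxE.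
Qed.

Lemma permanent_ge0 (R : realDomainType) (n : nat) (M : 'M[R]_n) :
  (forall i j, 0 <= M i j) -> 0 <= permanent M.
Proof. by move=> M0; apply: sumr_ge0 => s _; exact: prodr_ge0. Qed.

(** At [K = n] this is the Frobenius-König form of Hall's condition for the entries [>= t]. Since
    [K] is a parameter separate from [n], the property passes unchanged to minors. *)
Definition blocks_meet (R : realDomainType) (n K : nat) (M : 'M[R]_n) (t : R) :=
  forall S T : {set 'I_n}, (0 < #|S|)%N -> (0 < #|T|)%N -> (#|S| + #|T|)%N = K.+1 ->
  exists i j, [/\ i \in S, j \in T & t <= M i j].

(** If [S] violated Hall's condition, then [n + 1 - #|S|] columns outside its neighbourhood would
    form with [S] a block whose entries are all below [t]. Hence some permutation selects only
    entries [>= t], and the other terms are nonnegative. *)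
Lemma permanent_ge_exp (R : realDomainType) (n : nat) (M : 'M[R]_n) (t : R) :
  0 <= t -> (forall i j, 0 <= M i j) -> blocks_meet n M t -> t ^+ n <= permanent M.
Proof.
move=> t0 M0 Mt; pose N i := [set j | t <= M i j]%SET.
have [|f finj fN] := @Hall_marriage _ _ N.
  move=> S; set U := (\bigcup_(i in S) N i)%SET; rewrite leqNgt; apply/negP => US.
  have [T TU cT] : exists2 T : {set 'I_n}, T \subset ~: U & #|T| = (n.+1 - #|S|)%N.
    have : (n.+1 - #|S| <= #|~: U|)%N by have := cardsC U; rewrite card_ord; lia.
    move=> /card_geqP[s [su <- sU]]; exists [set x in s]%SET.
      by apply/fintype.subsetP => x; rewrite inE; exact: sU.
    by rewrite cardsE; exact/card_uniqP.
  have Sn : (#|S| <= n)%N by rewrite -[leqRHS]card_ord max_card.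
  have [|||i [j [iS jT tij]]] := Mt S T.
  - by apply: leq_ltn_trans US.
  - by rewrite cT subn_gt0 ltnS.
  - by rewrite cT subnKC// ltnW.
  have := fintype.subsetP TU _ jT; rewrite inE => /negP; apply.
  by apply/bigcupP; exists i => //; rewrite inE.
have -> : t ^+ n = \prod_(i < n) t by rewrite prodr_const card_ord.
rewrite /permanent (bigD1 (perm finj))//=.
apply: (@le_trans _ _ (\prod_(i < n) M i (perm finj i))).
  apply: ler_prod => i _; rewrite t0 permE /=.
  by have := fN i; rewrite inE.
by rewrite lerDl; apply: sumr_ge0 => s _; exact: prodr_ge0.
Qed.

(** Induction on the size with [K] fixed, starting from size [K]. In size [n + 1], blocks of one row
    and [K] columns leave at least [n + 1 - K] entries [>= t] in the first row; every minor inherits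
    the hypothesis, and these counts multiply to the factorial. *)
Lemma permanent_ge_fact (R : realDomainType) (n K : nat) (M : 'M[R]_n) (t : R) :
  0 <= t -> (forall i j, 0 <= M i j) -> (0 < K <= n)%N -> blocks_meet K M t ->
  t ^+ n * ((n - K)`!)%:R <= permanent M.
Proof.
move=> t0 M0 /andP[K0 Kn] Mt; elim: n M M0 Kn Mt => [|n IH] M M0 Kn Mt; first lia.
have [Kn1|Kn1] := eqVneq K n.+1.
  by rewrite Kn1 subnn mulr1; apply: permanent_ge_exp => //; rewrite Kn1 in Mt.
have {}Kn : (K <= n)%N by lia.
rewrite permanent_row0.
pose G := [set j | t <= M ord0 j]%SET.
have cG : (n.+1 - K <= #|G|)%N.
  rewrite leqNgt; apply/negP => hG.
  have : (K <= #|~: G|)%N by have := cardsC G; rewrite card_ord; lia.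
  move=> /card_geqP[s [su sK sG]].
  have [|||i [j [iS jT tij]]] := Mt [set ord0]%SET [set x in s]%SET.
  - by rewrite cards1.
  - by rewrite cardsE (card_uniqP su) sK.
  - by rewrite cards1 cardsE (card_uniqP su) sK.
  have := sG j; move: jT; rewrite inE => js /(_ js); rewrite inE => /negP; apply.
  by move: iS; rewrite !inE => /eqP <-.
have minor j : t ^+ n * ((n - K)`!)%:R <= permanent (row' ord0 (col' j M)).
  apply: IH => //; first by move=> i k; rewrite !mxE.
  move=> S T S0 T0 ST.
  have [|||i' [j' [/imsetP[i iS ->] /imsetP[k kT ->] tij]]] :=
    Mt (lift ord0 @: S)%SET (lift j @: T)%SET.
  - by rewrite card_imset //; exact: lift_inj.
  - by rewrite card_imset //; exact: lift_inj.
  - by rewrite !card_imset //; exact: lift_inj.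
  by exists i, k; split => //; rewrite !mxE.
apply: (@le_trans _ _ (\sum_(j in G) t * (t ^+ n * ((n - K)`!)%:R))).
  rewrite sumr_const -[leRHS]mulr_natl exprS (subSn Kn) factS natrM.
  rewrite [leLHS](_ : _ = (n - K).+1%:R * (t * (t ^+ n * ((n - K)`!)%:R))); last by ring.
  apply: ler_wpM2r; first by rewrite !mulr_ge0// ?exprn_ge0.
  by rewrite ler_nat -(subSn Kn).
rewrite [leRHS](bigID (mem G))/= -[leLHS]addr0; apply: lerD.
  apply: ler_sum => j; rewrite inE => tj; apply: ler_pM => //.
  by rewrite mulr_ge0// exprn_ge0.
apply: sumr_ge0 => j _; apply: mulr_ge0 => //.
by apply: permanent_ge0 => i k; rewrite !mxE.
Qed.

(** The expanded product has one nonnegative term for each map from rows to columns, and the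
    permanent keeps those of the bijective maps. *)
Lemma permanent_le_prod_sum (R : realDomainType) (n : nat) (M : 'M[R]_n) :
  (forall i j, 0 <= M i j) -> permanent M <= \prod_i \sum_j M i j.
Proof.
move=> M0; rewrite bigA_distr_bigA /=.
pose h (s : 'S_n) : {ffun 'I_n -> 'I_n} := [ffun i => s i].
have hinj : injective h.
  by move=> s t /ffunP e; apply/permP => i; have := e i; rewrite !ffunE.
rewrite (bigID (mem (h @: [set: 'S_n])%SET))/= -[leLHS]addr0; apply: lerD; last first.
  by apply: sumr_ge0 => f _; exact: prodr_ge0.
rewrite big_imset/=; last by move=> ? ? _ _; exact: hinj.
rewrite le_eqVlt; apply/orP; left; apply/eqP; apply: eq_big => [s|s _]; first by rewrite inE.
by apply: eq_bigr => i _; rewrite ffunE.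
Qed.

Lemma sum_le_prod1D (R : realDomainType) (I : finType) (x : I -> R) :
  (forall i, 0 <= x i) -> \sum_i x i <= \prod_i (1 + x i).
Proof.
move=> x0; suff [_] : 0 <= \sum_i x i /\ 1 + \sum_i x i <= \prod_i (1 + x i).
  by apply: le_trans; rewrite lerDr.
elim/big_rec2: _ => [|i s p _ [s0 sp]]; first by rewrite addr0.
split; first exact: addr_ge0.
apply: (@le_trans _ _ ((1 + x i) * (1 + s))).
  rewrite (_ : (1 + x i) * (1 + s) = 1 + (x i + s) + x i * s); last by ring.
  by rewrite lerDl mulr_ge0.
by apply: ler_wpM2l => //; rewrite addr_ge0.
Qed.

Lemma permanent_le_prod1D (R : realFieldType) (n : nat) (M : 'M[R]_n) (N : R) :
  0 < N -> (forall i j, 0 <= M i j) ->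
  permanent M <= N ^+ n * \prod_i \prod_j (1 + M i j / N).
Proof.
move=> N0 M0; apply: le_trans (permanent_le_prod_sum M0) _.
have -> : N ^+ n = \prod_(i < n) N by rewrite prodr_const card_ord.
rewrite -big_split /=; apply: ler_prod => i _; rewrite sumr_ge0//=.
rewrite -ler_pdivrMl// mulr_sumr; apply: le_trans (sum_le_prod1D _) _.
  by move=> j; rewrite mulr_ge0// invr_ge0 ltW.
by rewrite le_eqVlt; apply/orP; left; apply/eqP; apply: eq_bigr => j _; rewrite mulrC.
Qed.

(** * Probability bounds *)

Section Probability.
Context d (Omega : measurableType d) (R : realType) (P : probability Omega R).

Lemma probability_bigsetU_le (I : Type) (s : seq I) (Q : pred I)
    (F : I -> set Omega) (f : I -> R) :
  (forall i, Q i -> measurable (F i)) -> (forall i, Q i -> (P (F i) <= (f i)%:E)%E) ->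
  (P (\big[setU/set0]_(i <- s | Q i) F i) <= (\sum_(i <- s | Q i) f i)%:E)%E.
Proof.
move=> mF Ff; elim: s => [|i s IH]; first by rewrite !big_nil measure0.
rewrite !big_cons; case: ifPn => // Qi.
rewrite EFinD; apply: le_trans (leeD (Ff _ Qi) IH).
by apply: measureU2; [exact: mF|exact: bigsetU_measurable].
Qed.

Lemma sum_inv_mulS (n : nat) :
  \sum_(0 <= k < n) ((k.+1 * k.+2)%:R)^-1 = 1 - n.+1%:R^-1 :> R.
Proof.
elim: n => [|n IH]; first by rewrite big_nil invr1 subrr.
rewrite big_nat_recr//= IH natrM -[n.+2%:R]natr1 -[n.+1%:R]natr1.
have := ler0n R n; move: (n%:R) => x x0; field.
by apply/andP; split; apply: lt0r_neq0; lra.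
Qed.

Lemma Borel_Cantelli_near (F : nat -> set Omega) :
  (forall n, measurable (F n)) ->
  (\forall n \near \oo, (P (F n) <= ((n * n.+1)%:R^-1)%:E)%E) ->
  {ae P, forall w, \forall n \near \oo, ~ F n w}.
Proof.
move=> mF [m _ Fm].
(* The shift skips the indices where the bound may fail, and compares [P (G k)] with the term
   [1 / ((k + 1) (k + 2))] of a telescoping series. *)
pose G n := F (n + m.+1)%N.
have mG n : measurable (G n) by exact: mF.
have G0 : P (lim_sup_set G) = 0%E.
  apply: lim_sup_set_cvg0 => //.
  apply: (@le_lt_trans _ _ 1%E); last exact: ltry.
  apply: lime_le; first by apply: is_cvg_nneseries => n _ _; exact: measure_ge0.
  apply: nearW => n.
  apply: (@le_trans _ _ (\sum_(0 <= k < n) ((k.+1 * k.+2)%:R^-1)%:E)%E).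
    apply: lee_sum => k _; apply: le_trans (Fm _ _) _; first by rewrite /=; lia.
    rewrite lee_fin lef_pV2 ?posrE ?ltr0n ?muln_gt0 ?addnS// ler_nat.
    by apply: leq_mul; rewrite !ltnS leq_addr.
  by rewrite sumEFin sum_inv_mulS lee_fin gerBl invr_ge0.
have mL : measurable (lim_sup_set G).
  by apply: bigcap_measurable => // k _; exact: bigcup_measurable.
exists (lim_sup_set G); split => // w /= nw n _.
apply: contrapT => Gn; apply: nw; exists (n + m.+1)%N => // k /= nk Fk.
apply: Gn; exists (k - m.+1)%N; first by rewrite /=; lia.
by rewrite /G subnK//; lia.
Qed.

Lemma Markov_ge0 (f : Omega -> R) (c V : R) :
  measurable_fun setT f -> (forall w, 0 <= f w) -> 0 < V ->
  (\int[P]_w (f w)%:E <= c%:E)%E -> (P [set w | (V <= f w)%R] <= (c / V)%:E)%E.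
Proof.
move=> mf f0 V0 fc; rewrite EFinM -lee_pdivrMr ?invr_gt0// invrK muleC.
apply: le_trans fc.
have := le_integral_abse P measurableT (proj2 (measurable_EFinP _ _) mf) V0.
have -> : [set x | (V%:E <= `|(EFin \o f) x|)%E] = [set w | (V <= f w)%R].
  by apply/seteqP; split => w /=; rewrite lee_fin ger0_norm.
rewrite setTI; under eq_integral do rewrite /= ger0_norm//.
by [].
Qed.

Lemma measurable_RV_lt (Y : {RV P >-> R}) (t : R) : measurable [set w | Y w < t].
Proof.
rewrite (_ : [set w | _] = Y @^-1` `]-oo, t[).
  by rewrite -[X in measurable X]setTI; exact: measurable_funPT.
by apply/seteqP; split => w /=; rewrite in_itv.
Qed.

Lemma measurable_RV_ge (Y : {RV P >-> R}) (t : R) : measurable [set w | t <= Y w].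
Proof.
rewrite (_ : [set w | _] = Y @^-1` `[t, +oo[).
  by rewrite -[X in measurable X]setTI; exact: measurable_funPT.
by apply/seteqP; split => w /=; rewrite in_itv/= andbT.
Qed.

Section Independent.
Context (I : finType) (D : {set I}) (X : I -> {RV P >-> R}).
Hypothesis indep : independent_RVs D X.

(** Expanding the product over the choices [f] of one index [k] per position makes each term a
    constant times the indicator of an intersection [E f], to which the product formula for events
    applies directly. *)
Lemma indep_expectation_prod (L : nat) (a : 'I_L.+1 -> R) (B : 'I_L.+1 -> set R) :
  (forall k, 0 <= a k) -> (forall k, measurable (B k)) ->
  (\int[P]_w (\prod_(q in D) \sum_k a k * \1_(X q @^-1` B k) w)%:E =
   (\prod_(q in D) \sum_k a k * fine (P (X q @^-1` B k)))%:E)%E.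
Proof.
move=> a0 mB.
have mX q k : measurable (X q @^-1` B k).
  by rewrite -[X in measurable X]setTI; exact: measurable_funPT.
rewrite (big_distr_big ord0) /=.
under eq_integral do rewrite (big_distr_big ord0) /= -sumEFin.
pose E (f : {ffun I -> 'I_L.+1}) := \bigcap_(q in [set` D]) (X q @^-1` B (f q)).
have mE f : measurable (E f).
  apply: fin_bigcap_measurable => // *.
have termE (f : {ffun I -> 'I_L.+1}) w : \prod_(q in D) (a (f q) * \1_(X q @^-1` B (f q)) w) =
    (\prod_(q in D) a (f q)) * \1_(E f) w.
  rewrite big_split /=; congr (_ * _).
  rewrite !indicE; have [|] := boolP (w \in E f).
    rewrite inE => Ew; rewrite big1// => q qD.
    by rewrite indicE mem_set//; exact: Ew.
  rewrite notin_setE => Ew; have [q qD Xq] : exists2 q, q \in D & ~ B (f q) (X q w).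
    by apply: contrapT => nE; apply: Ew => q /= qD; apply: contrapT => nB; apply: nE; exists q.
  by rewrite (bigD1 q)//= indicE memNset// mul0r.
under eq_integral do under eq_bigr do rewrite termE.
rewrite -big_filter; under eq_integral do rewrite -big_filter.
rewrite ge0_integral_sum//; last 2 first.
- move=> f; apply: measurableT_comp => //.
  by apply: measurable_funM => //; exact: measurable_indic.
- by move=> f w _; rewrite lee_fin mulr_ge0// prodr_ge0.
rewrite -sumEFin; apply: eq_bigr => f _.
under eq_integral do rewrite EFinM.
rewrite ge0_integralZl//; last 2 first.
- by apply: measurableT_comp => //; exact: measurable_indic.
- by rewrite lee_fin prodr_ge0.
rewrite integral_indic// setIT.
have fk q k : P (X q @^-1` B k) = (fine (P (X q @^-1` B k)))%:E.
  by rewrite fineK// fin_num_measure.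
have PE : P (E f) = (\prod_(q in D) fine (P (X q @^-1` B (f q))))%:E.
  rewrite -prodEFin; under eq_bigr do rewrite -fk.
  exact: indep.
transitivity ((\prod_(q in D) a (f q))%:E * P (E f))%E; first by [].
by rewrite PE -EFinM big_split.
Qed.

Lemma indep_all_lt (t a : R) (J : {set I}) : J \subset D ->
  (forall q, q \in D -> (P [set w | (X q w < t)%R] <= (expR (- a))%:E)%E) ->
  (P (\bigcap_(q in [set` J]) [set w | (X q w < t)%R]) <= (expR (- (a * #|J|%:R)))%:E)%E.
Proof.
move=> JD Xa.
have pE q : [set w | (X q w < t)%R] = X q @^-1` `]-oo, t[.
  by apply/seteqP; split => w /=; rewrite in_itv.
under eq_bigcapr do rewrite pE.
rewrite (indep (B := fun=> `]-oo, t[%classic))//.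
have fk q : P (X q @^-1` `]-oo, t[) = (fine (P (X q @^-1` `]-oo, t[)))%:E.
  rewrite fineK// fin_num_measure//.
  by rewrite -[X in measurable X]setTI; exact: measurable_funPT.
under eq_bigr do rewrite fk.
rewrite prodEFin lee_fin mulrC -mulrN expRM_natl -prodr_const.
apply: ler_prod => q qJ; rewrite fine_ge0//= -lee_fin -fk -pE.
by apply: Xa; exact: (fintype.subsetP JD).
Qed.

End Independent.
End Probability.

(** * Sums over blocks, for the union bounds *)

Lemma sum_exp_card (R : comNzRingType) (I : finType) (z : R) :
  \sum_(S : {set I}) z ^+ #|S| = (1 + z) ^+ #|I|.
Proof.
rewrite addrC -prodr_const bigA_distr /=; apply: eq_bigr => S _.
by rewrite -prodr_const [LHS]big_mkcond.
Qed.

Lemma sum_exp_cardC (R : comNzRingType) (I : finType) (z : R) :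
  \sum_(S : {set I}) z ^+ #|~: S| = (1 + z) ^+ #|I|.
Proof.
rewrite -sum_exp_card (reindex_inj (inv_inj (@finset.setCK I))) /=.
by apply: eq_bigr => S _; rewrite finset.setCK.
Qed.

Definition block_pair (n K : nat) (p : {set 'I_n} * {set 'I_n}) : bool :=
  [&& (0 < #|p.1|)%N, (0 < #|p.2|)%N & #|p.1| + #|p.2| == K.+1]%N.

Section BlockSums.
Context (R : realType) (n : nat) (a : R).
Hypothesis a_ge0 : 0 <= a.

(** There are at most [4 ^ n] pairs, and two positive integers of sum [K + 1] have product at least
    [K]. The division by 2 in the exponent is the cost of symmetry. *)
Lemma sum_block_pairs_le (K : nat) :
  \sum_(p | @block_pair n K p) expR (- (a * (#|p.1| * #|p.2|)%:R / 2)) <=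
  4 ^+ n * expR (- (a * K%:R / 2)).
Proof.
apply: (@le_trans _ _ (\sum_(p : {set 'I_n} * {set 'I_n}) expR (- (a * K%:R / 2)))).
  rewrite big_mkcond; apply: ler_sum => p _; case: ifPn => [|_]; last exact: expR_ge0.
  move=> /and3P[p1 p2 /eqP pK]; rewrite ler_expR lerN2 ler_pM2r ?invr_gt0//.
  rewrite ler_wpM2l// ler_nat; move: p1 p2 pK.
  by case: #|p.1| => // s _; case: #|p.2| => // t _; rewrite mulSn mulnS; lia.
have card2 : #|{: {set 'I_n} * {set 'I_n}}| = (4 ^ n)%N.
  have cn : #|{set 'I_n}| = (2 ^ n)%N.
    by rewrite -[n in RHS]card_ord -[#|_| in RHS]cardsT -card_powerset powersetT cardsT.
  by rewrite card_prod cn -expnMn.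
by rewrite sumr_const card2 -[leLHS]mulr_natl natrX.
Qed.

(* With [m = min(#|S|, #|T|)] and [#|S| + #|T| = n + 1], [#|S| * #|T| >= m n / 2]
   while [2 m - 1] is [#|S| + #|~: T|] or [#|~: S| + #|T|]; hence each term is at
   most [z] times a product of a weight of [S] and a weight of [T]. *)
Lemma sum_full_block_pairs_le (z := expR (- (a * n%:R / 8))) :
  \sum_(p | @block_pair n n p) expR (- (a * (#|p.1| * #|p.2|)%:R / 2)) <=
  2 * z * expR (2 * n%:R * z).
Proof.
have z0 : 0 <= z by exact: expR_ge0.
apply: (@le_trans _ _ (\sum_(p : {set 'I_n} * {set 'I_n})
    z * (z ^+ #|p.1| * z ^+ #|~: p.2| + z ^+ #|~: p.1| * z ^+ #|p.2|))).
  rewrite big_mkcond; apply: ler_sum => -[S T] _ /=; case: ifPn => [|_]; last first.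
    by rewrite mulr_ge0// addr_ge0// mulr_ge0// exprn_ge0.
  move=> /and3P[/= p1 p2 /eqP/= pK].
  have zexp m : z ^+ m = expR (- (a * n%:R / 8) * m%:R) by rewrite expRM_natr.
  have cS := cardsC S; have cT := cardsC T; rewrite !card_ord in cS cT.
  have compl s t t' : (s + t = n.+1)%N -> (t + t' = n)%N -> t' = s.-1 by lia.
  have main (s t : nat) : (0 < s <= t)%N -> (s + t = n.+1)%N ->
      expR (- (a * (s * t)%:R / 2)) <= z * (z ^+ s * z ^+ s.-1).
    move=> st stn; rewrite -exprD -exprS zexp ler_expR mulNr lerN2.
    have : (n%:R * (s + s.-1).+1%:R <= 4 * (s * t)%:R :> R).
      by rewrite -!natrM ler_nat; nia.
    by move=> /(ler_wpM2l a_ge0); lra.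
  rewrite mulrDr; have [st|ts] := leqP #|S| #|T|.
    rewrite (_ : #|~: T| = #|S|.-1); last exact: (compl _ _ _ pK cT).
    apply: le_trans (main _ _ _ pK) _; first by rewrite p1.
    by rewrite lerDl mulr_ge0// mulr_ge0// exprn_ge0.
  rewrite (_ : #|~: S| = #|T|.-1); last by apply: (compl _ _ _ _ cS); rewrite addnC.
  rewrite (mulnC #|S|) [in leRHS](mulrC (z ^+ _) (z ^+ #|T|)).
  apply: le_trans (main _ _ _ _) _; [by rewrite p2 ltnW|by rewrite addnC|].
  by rewrite lerDr mulr_ge0// mulr_ge0// exprn_ge0.
rewrite -mulr_sumr big_split /= -(pair_big xpredT xpredT
  (fun S T : {set 'I_n} => z ^+ #|S| * z ^+ #|~: T|)) -(pair_big xpredT xpredT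
  (fun S T : {set 'I_n} => z ^+ #|~: S| * z ^+ #|T|)) /= -!big_distrlr /=.
rewrite !sum_exp_card !sum_exp_cardC card_ord -exprD.
rewrite (_ : z * _ = 2 * z * (1 + z) ^+ (n + n)); last by ring.
rewrite ler_wpM2l ?mulr_ge0//.
rewrite (_ : 2 * n%:R * z = (n + n)%:R * z); last by rewrite natrD; ring.
by rewrite expRM_natl lerXn2r ?nnegrE ?addr_ge0 ?expR_ge0// expR_ge1Dx.
Qed.

End BlockSums.

(** * Matrices read off a family of independent entries *)

Section Array.
Context d (Omega : measurableType d) (R : realType) (P : probability Omega R).
Context (n : nat) (X : 'I_n * 'I_n -> {RV P >-> R}).
Context (D : {set 'I_n * 'I_n}) (c : 'I_n * 'I_n -> 'I_n * 'I_n).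
(* [c] sends a position to the one that carries its independent entry: the identity
   in case I, the reordering [i <= j] in case II. *)
Hypothesis indep : independent_RVs D X.
Hypothesis cD : forall q, c q \in D.
Hypothesis c_swap : forall q, c q = q \/ c q = (q.2, q.1).

(** Reading each position through [c] treats both cases at once: the matrix becomes a function of
    the independent entries at every [w], while symmetry of the given matrix is only almost sure. *)
Definition array (w : Omega) : 'M[R]_n := \matrix_(i, j) X (c (i, j)) w.

(** [Q] lies in the union of its image under [c] and the transpose of that image. *)
Lemma card_canonical (Q : {set 'I_n * 'I_n}) : (#|Q| <= 2 * #|(c @: Q)%SET|)%N.
Proof.
pose sw (q : 'I_n * 'I_n) := (q.2, q.1).
have swK : cancel sw sw by case.
apply: (@leq_trans #|(c @: Q) :|: (sw @: (c @: Q))|).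
  apply/subset_leq_card/fintype.subsetP => q qQ; rewrite inE; apply/orP.
  have [cq|cq] := c_swap q; [left|right].
    by rewrite -{1}cq imset_f.
  by rewrite -[q]swK imset_f// -[sw q]cq imset_f.
by rewrite (leq_trans (leq_card_setU _ _).1)// mul2n -addnn leq_add2l leq_imset_card.
Qed.

(** The fibre of [c] over [q] is contained in [q] and its transpose, so each independent entry is
    counted at most twice. *)
Lemma sum_canonical_le (h : 'I_n * 'I_n -> R) : (forall q, 0 <= h q) ->
  \sum_q h (c q) <= 2 * \sum_(q in D) h q.
Proof.
move=> h0; rewrite (partition_big c (mem D))//= mulr_sumr; apply: ler_sum => q _.
rewrite (eq_bigr (fun=> h q)); last by move=> r /eqP ->.
rewrite (eq_bigl (fun r => r \in [set r | c r == q]%SET)); last by move=> r; rewrite inE.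
rewrite sumr_const -[leLHS]mulr_natl ler_wpM2r// ler_nat.
rewrite (leq_trans (subset_leq_card (_ : _ \subset [set q; (q.2, q.1)]%SET)))//.
  apply/fintype.subsetP => r; rewrite inE => /eqP <-; rewrite !inE.
  by have [->|->] := c_swap r; [rewrite eqxx | rewrite /= -surjective_pairing eqxx orbT].
by rewrite cards2; case: (_ != _).
Qed.

(** The image under [c] lists each independent entry of a block once, so that independence applies
    to the intersection. *)
Definition small_block (K : nat) (t : R) : set Omega :=
  \big[setU/set0]_(p | @block_pair n K p)
    \bigcap_(q in [set` (c @: finset.setX p.1 p.2)%SET]) [set w | X q w < t].

Lemma measurable_block (J : {set 'I_n * 'I_n}) t :
  measurable (\bigcap_(q in [set` J]) [set w | X q w < t]).
Proof. by apply: fin_bigcap_measurable => // q _; exact: measurable_RV_lt. Qed.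

Lemma measurable_small_block K t : measurable (small_block K t).
Proof. by apply: bigsetU_measurable => p _; exact: measurable_block. Qed.

Lemma blocks_meet_array K t w : ~ small_block K t w -> blocks_meet K (array w) t.
Proof.
move=> nb S T S0 T0 ST; apply: contrapT => ne; apply: nb.
rewrite /small_block -bigcup_seq_cond; exists (S, T).
  by rewrite /= mem_index_enum /block_pair/= S0 T0 ST eqxx.
move=> q /= /imsetP[[i j]]; rewrite inE /= => /andP[iS jT] ->.
rewrite ltNge; apply/negP => tX; apply: ne.
by exists i, j; split => //; rewrite mxE.
Qed.

Lemma probability_small_block_le K (t a : R) : 0 <= a ->
  (forall q, q \in D -> (P [set w | (X q w < t)%R] <= (expR (- a))%:E)%E) ->
  (P (small_block K t) <=
   (\sum_(p | @block_pair n K p) expR (- (a * (#|p.1| * #|p.2|)%:R / 2)))%:E)%E.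
Proof.
move=> a0 Xa; apply: probability_bigsetU_le => [p _|p _]; first exact: measurable_block.
apply: le_trans (indep_all_lt indep _ Xa) _.
  by apply/fintype.subsetP => q /imsetP[r _ ->].
rewrite lee_fin ler_expR lerN2 -mulrA ler_wpM2l// ler_pdivrMr//.
by rewrite -natrM ler_nat [leqRHS]mulnC -cardsX card_canonical.
Qed.

(** At most [n ^ 2] independent factors, each of mean at most [1 + 1 / n <= exp (1 / n)], have a
    product of mean at most [exp n]; Markov's inequality at [exp (2 n)] concludes. *)
Lemma probability_prod_ge (L : nat) (b : 'I_L.+1 -> R) (B : 'I_L.+1 -> set R) :
  (0 < n)%N ->
  (forall k, 0 <= b k) -> (forall k, measurable (B k)) ->
  (forall q, q \in D -> \sum_k b k * fine (P (X q @^-1` B k)) <= 1 + n%:R^-1) ->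
  measurable [set w | expR (2 * n%:R) <= \prod_(q in D) \sum_k b k * \1_(X q @^-1` B k) w] /\
  (P [set w | (expR (2 * n%:R) <= \prod_(q in D) \sum_k b k * \1_(X q @^-1` B k) w)%R] <=
   (expR (- n%:R))%:E)%E.
Proof.
move=> n0 b0 mB Eb; set W := fun w => \prod_(q in D) \sum_k b k * \1_(X q @^-1` B k) w.
have mX q k : measurable (X q @^-1` B k).
  by rewrite -[X in measurable X]setTI; exact: measurable_funPT.
have mW : measurable_fun setT W.
  rewrite /W; under eq_fun do rewrite -big_filter.
  apply: measurable_prod => q _; apply: measurable_sum => k.
  by apply: measurable_funM => //; exact: measurable_indic.
have W0 w : 0 <= W w.
  by apply: prodr_ge0 => q _; apply: sumr_ge0 => k _; rewrite mulr_ge0.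
split.
  rewrite (_ : [set w | _] = W @^-1` `[expR (2 * n%:R), +oo[).
    by rewrite -[X in measurable X]setTI; exact: mW.
  by apply/seteqP; split => w /=; rewrite in_itv/= andbT.
rewrite (_ : - n%:R = n%:R - 2 * n%:R); last by ring.
rewrite expRB; apply: Markov_ge0 => //.
rewrite (indep_expectation_prod indep)// lee_fin.
apply: (@le_trans _ _ (\prod_(q in D) expR n%:R^-1)).
  apply: ler_prod => q qD; rewrite (le_trans (Eb _ qD)) ?expR_ge1Dx// andbT.
  by apply: sumr_ge0 => k _; rewrite mulr_ge0// fine_ge0.
rewrite prodr_const -expRM_natl ler_expR ler_pdivrMr ?ltr0n// -natrM ler_nat.
by rewrite (leq_trans (max_card _))// card_prod card_ord.
Qed.

End Array.

(** * Asymptotic estimates *)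

Section Asymptotics.
Context (R : realType).

Lemma near_ln_ge (A : R) : \forall n \near \oo, A <= ln (n%:R : R).
Proof.
near=> n; rewrite -[A]expRK ler_ln ?posrE ?expR_gt0//.
  by near: n; exact: nbhs_infty_ger.
by rewrite ltr0n; near: n; exact: nbhs_infty_gt.
Unshelve. all: by end_near. Qed.

Lemma near_expRN_le : \forall n \near \oo, expR (- n%:R) <= (n ^ 3)%:R^-1 :> R.
Proof.
near=> n.
have n24 : (24 < n)%N by near: n; exact: nbhs_infty_gt.
rewrite expRN lef_pV2 ?posrE ?expR_gt0 ?ltr0n ?expn_gt0 ?(leq_trans _ n24)//.
(* Here [exp n >= n ^ 4 / 4!], and [n > 24] cancels the factorial. *)
apply: le_trans (expR_ge1Dxn 3 (ler0n _ n)).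
rewrite -[leLHS]add0r lerD// ler_pdivlMr ?ltr0n// -natrX -natrM ler_nat.
by rewrite (_ : 4`! = 24)%N// [in leqRHS]expnSr leq_mul2l ltnW ?orbT.
Unshelve. all: by end_near. Qed.

Lemma near_expRN_le_inv : \forall n \near \oo, expR (- n%:R) <= (n * n.+1)%:R^-1 :> R.
Proof.
near=> n.
have n2 : (2 < n)%N by near: n; exact: nbhs_infty_gt.
have : expR (- n%:R) <= (n ^ 3)%:R^-1 :> R by near: n; exact: near_expRN_le.
move=> /le_trans; apply; rewrite lef_pV2 ?posrE ?ltr0n ?muln_gt0 ?expn_gt0 ?andbT; try lia.
by rewrite ler_nat !expnS expn0 leq_mul2l; nia.
Unshelve. all: by end_near. Qed.

Lemma expRM_natln (k n : nat) : (0 < n)%N -> expR (k%:R * ln n%:R) = (n ^ k)%:R :> R.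
Proof. by move=> n0; rewrite expRM_natl lnK ?natrX// posrE ltr0n. Qed.

Lemma expR_le2 (x : R) : x <= 2^-1 -> expR x <= 2.
Proof.
move=> x2; rewrite -[leLHS]invrK -expRN -[2]invrK lef_pV2 ?posrE ?expR_gt0//.
by apply: le_trans (expR_ge1Dx _); lra.
Qed.

Lemma expR2_ge4 : 4 <= expR 2 :> R.
Proof.
have e1 : 2 <= expR 1 :> R by rewrite (le_trans _ (expR_ge1Dx _))//; lra.
rewrite (_ : 2 = 1 + 1 :> R)// expRD; nra.
Qed.

(** With [z <= n ^ -5] the exponential is at most 2, leaving [4 n ^ -5]. This makes the bound of
    [sum_full_block_pairs_le] summable. *)
Lemma full_block_sum_le (n : nat) (z : R) : (4 < n)%N ->
  0 <= z -> z <= expR (- (5 * ln n%:R)) ->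
  2 * z * expR (2 * n%:R * z) <= (n * n.+1)%:R^-1.
Proof.
move=> n4 z0; have n0 : (0 < n)%N by lia.
rewrite expRN expRM_natln// => zn.
have e2 : expR (2 * n%:R * z) <= 2.
  apply: expR_le2; apply: (@le_trans _ _ (2 * n%:R * (n ^ 5)%:R^-1)).
    by rewrite ler_wpM2l// mulr_ge0.
  rewrite ler_pdivrMr ?ltr0n ?expn_gt0 ?n0// [leRHS]mulrC ler_pdivlMr ?ltr0n//.
  rewrite -!natrM ler_nat mulnAC mulnC expnS leq_mul2l (@leq_trans n) ?orbT//; first lia.
  by rewrite expnS leq_pmulr// expn_gt0 n0.
apply: (@le_trans _ _ (2 * (n ^ 5)%:R^-1 * 2)).
  by apply: ler_pM => //; rewrite ?mulr_ge0 ?expR_ge0// ler_wpM2l.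
rewrite mulrAC ler_pdivrMr ?ltr0n ?expn_gt0 ?n0// [leRHS]mulrC ler_pdivlMr ?ltr0n ?muln_gt0 ?n0//.
rewrite -!natrM ler_nat !expnS expn0 muln1.
have h : (n.+1 <= 2 * n)%N by lia.
apply: (@leq_trans (4 * (n * (2 * n)))); first by rewrite leq_mul2l leq_mul2l h !orbT.
rewrite (_ : 4 * _ = n * (n * 8))%N; last lia.
by rewrite !leq_mul2l; nia.
Qed.

(** As [r (n %/ r + 1) >= n], the exponent is at most [- 3 n]; it beats [4 ^ n <= exp (2 n)] and
    leaves [exp (- n)]. *)
Lemma near_block_sum (r : nat) : (0 < r)%N ->
  \forall n \near \oo,
  4 ^+ n * expR (- (6 * r%:R * (n %/ r).+1%:R / 2)) <= (n * n.+1)%:R^-1 :> R.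
Proof.
move=> r0; near=> n.
have : expR (- n%:R) <= (n * n.+1)%:R^-1 :> R by near: n; exact: near_expRN_le_inv.
apply: le_trans.
have nr : n%:R <= r%:R * (n %/ r).+1%:R :> R.
  by rewrite -natrM ler_nat mulnC mulSn addnC {1}(divn_eq n r) leq_add2l ltnW// ltn_pmod.
apply: (@le_trans _ _ (expR (n%:R * 2) * expR (- (3 * n%:R)))).
  apply: ler_pM; rewrite ?exprn_ge0 ?expR_ge0//.
    by rewrite expRM_natl lerXn2r ?nnegrE ?expR_ge0 ?expR2_ge4.
  by rewrite ler_expR lerN2; lra.
by rewrite -expRD ler_expR; lra.
Unshelve. all: by end_near. Qed.

Lemma near_expRN_cube_le : \forall n \near \oo,
  expR (- n%:R) + (n ^ 3)%:R^-1 <= (n * n.+1)%:R^-1 :> R.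
Proof.
near=> n.
have n3 : (3 < n)%N by near: n; exact: nbhs_infty_gt.
have : expR (- n%:R) <= (n ^ 3)%:R^-1 :> R by near: n; exact: near_expRN_le.
move=> h; apply: (@le_trans _ _ (2 * (n ^ 3)%:R^-1)); first by lra.
rewrite ler_pdivrMr ?ltr0n ?expn_gt0 ?(leq_trans _ n3)// [leRHS]mulrC ler_pdivlMr ?ltr0n ?muln_gt0 ?(leq_trans _ n3)//.
rewrite -!natrM ler_nat !expnS expn0 muln1 mulnCA leq_mul2l; nia.
Unshelve. all: by end_near. Qed.

(** The quadratic term of the exponential series suffices once [ln n >= 2 C / b ^ 2]. *)
Lemma near_linear_le_expR (b C : R) : 0 < b ->
  \forall n \near \oo, C * ln n%:R <= expR (b * ln (n%:R : R)).
Proof.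
move=> b0; near=> n.
have l0 : 0 <= ln (n%:R : R) by near: n; exact: near_ln_ge.
have lC : 2 * C / b ^+ 2 <= ln (n%:R : R) by near: n; exact: near_ln_ge.
move: (ln n%:R) l0 lC => l l0 lC.
apply: le_trans (expR_ge1Dxn 1 (mulr_ge0 (ltW b0) l0)).
rewrite (_ : 2`! = 2)%N// ler_pdivrMr ?exprn_gt0// in lC *.
rewrite -[leLHS]add0r lerD// ler_pdivlMr// exprMn.
nra.
Unshelve. all: by end_near. Qed.

(** The last [m - k] factors of the factorial are all larger than [k]. This plays the part of
    Stirling's formula. *)
Lemma fact_ge_exp (k m : nat) : (k <= m)%N -> (k ^ (m - k) <= m`!)%N.
Proof.
elim: m => [|m IH]; first by rewrite leqn0 => /eqP ->.
rewrite leq_eqVlt => /predU1P[->|]; first by rewrite subnn fact_gt0.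
rewrite ltnS => km; rewrite subSn// expnS factS leq_mul ?IH//.
exact: (leq_trans km).
Qed.

Lemma tail_le (F : R -> R) (b p : R) : (forall t, 0 <= F t) -> p < b ->
  ln (F t) / ln t @[t --> +oo] --> - b ->
  \forall t \near +oo, F t <= expR (- (p * ln t)).
Proof.
move=> F0 pb Fb; near=> t.
have : ln (F t) / ln t < - p by near: t; apply: cvgr_lt Fb _ _; rewrite ltrN2.
have lt0 : 0 < ln t by rewrite ln_gt0//; near: t; exact: nbhs_pinfty_gt.
rewrite ltr_pdivrMr// mulNr => h.
(* Where [F t = 0] the logarithm takes its default value 0 and cannot be inverted, but the bound is
   trivial. *)
have [->|Ft] := eqVneq (F t) 0; first exact: expR_ge0.
have {}Ft : 0 < F t by rewrite lt_neqAle eq_sym Ft F0.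
by rewrite -[leLHS]lnK ?posrE// ler_expR ltW.
Unshelve. all: by end_near. Qed.

(* Since [ln 0 = 0] here, it is the negativity of the limit that excludes [F t = 0]. *)
Lemma tail_ge (F : R -> R) (b p : R) : (forall t, 0 <= F t) -> 0 < b -> b < p ->
  ln (F t) / ln t @[t --> +oo] --> - b ->
  \forall t \near +oo, expR (- (p * ln t)) <= F t.
Proof.
move=> F0 b0 bp Fb; near=> t.
have : - p < ln (F t) / ln t by near: t; apply: cvgr_gt Fb _ _; rewrite ltrN2.
have : ln (F t) / ln t < 0 by near: t; apply: cvgr_lt Fb _ _; rewrite oppr_lt0.
have lt0 : 0 < ln t by rewrite ln_gt0//; near: t; exact: nbhs_pinfty_gt.
rewrite ltr_pdivrMr// mul0r ltr_pdivlMr// mulNr => Fn h.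
have [F00|Ft] := eqVneq (F t) 0; first by rewrite F00 ln0// ltxx in Fn.
have {}Ft : 0 < F t by rewrite lt_neqAle eq_sym Ft F0.
by rewrite -[leRHS]lnK ?posrE// ler_expR ltW.
Unshelve. all: by end_near. Qed.

(** The numbers [1 / (1 + y)] and [y / (1 + y)] lie in the unit interval and sum to 1; each is at
    most its [p]-th power, so those powers sum to at least 1. *)
Lemma powR1D_le (y p : R) : 0 <= y -> 0 < p <= 1 -> (1 + y) `^ p <= 1 + y `^ p.
Proof.
move=> y0 /andP[p0 p1]; have y1 : 0 < 1 + y by rewrite ltr_wpDr.
have frac x : 0 <= x -> x <= 1 -> x <= x `^ p.
  move=> x0 x1; have [->|xn0] := eqVneq x 0; first by rewrite powR_ge0.
  by apply: ger1_powR => //; rewrite lt_neqAle eq_sym xn0 x0.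
have a0 : 0 <= (1 + y)^-1 by rewrite invr_ge0 ltW.
have fa : (1 + y)^-1 <= (1 + y)^-1 `^ p by apply: frac => //; rewrite invf_le1// lerDl.
have fb : y / (1 + y) <= (y / (1 + y)) `^ p.
  by apply: frac; rewrite ?mulr_ge0// ler_pdivrMr// mul1r lerDr.
have one : (1 + y) `^ p * (1 + y)^-1 `^ p = 1.
  by rewrite -(powRM p (ltW y1) a0) divff ?powR1// gt_eqF.
have ab : (1 + y)^-1 + y / (1 + y) = 1 by field; rewrite gt_eqF.
apply: (@le_trans _ _ ((1 + y) `^ p * ((1 + y)^-1 `^ p + (y / (1 + y)) `^ p))).
  by rewrite -[leLHS]mulr1 ler_wpM2l ?powR_ge0// -[leLHS]ab lerD.
by rewrite mulrDr one powRM// mulrCA one mulr1.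
Qed.

End Asymptotics.

(** * Bounds for one array *)

(** [Q n] may fail to be measurable, and exceptional events are supplied only for large [n]: one is
    chosen wherever it exists, and the empty set elsewhere. *)
Lemma Borel_Cantelli_exists d (Omega : measurableType d) (R : realType)
    (P : probability Omega R) (Q : nat -> Omega -> Prop) :
  (\forall n \near \oo, exists E, [/\ measurable E,
     (P E <= ((n * n.+1)%:R^-1)%:E)%E & forall w, ~ E w -> Q n w]) ->
  {ae P, forall w, \forall n \near \oo, Q n w}.
Proof.
move=> hE; pose good n E := [/\ measurable E,
  (P E <= ((n * n.+1)%:R^-1)%:E)%E & forall w, ~ E w -> Q n w].
pose F n := if pselect (exists E, good n E) is left h then projT1 (cid h) else set0.
have FE n : (exists E, good n E) -> good n (F n).
  by rewrite /F; case: pselect => // h _; case: (cid h).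
have mF n : measurable (F n).
  by rewrite /F; case: pselect => // h; case: (cid h) => E [].
have : {ae P, forall w, \forall n \near \oo, ~ F n w}.
  apply: Borel_Cantelli_near => //.
  by apply: filterS hE => n /FE[].
apply: filterS => w; apply: filterS2 hE => n /FE[_ _ h]; exact: h.
Qed.

Section Levels.
Context (R : realType) (p eta nu l : R) (L : nat).
Hypotheses (p01 : 0 < p <= 1) (eta_gt0 : 0 < eta) (l_ge0 : 0 <= l).
Hypothesis nu_ge : 1 <= nu - eta.

(* With [l = ln n], [level k] is [n ^ (eta k)], and the [k]-th weight is the [p]-th power
   of [level k.+1 / n ^ nu]: the weighted sum of indicators below dominates
   [(1 + x / n ^ nu) ^ p] up to a factor [exp (p / n)]. *)
Definition level (k : nat) : R := expR (eta * k%:R * l).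

(** Index 0 carries the constant term 1. An index [k > 0] serves the values between [level k] and
    [level k.+1]: the set uses the lower end and the weight the upper one. *)
Definition level_set (k : 'I_L.+1) : set R :=
  if k == ord0 then setT else `[level k, +oo[%classic.

Definition level_weight (k : 'I_L.+1) : R :=
  if k == ord0 then 1 else expR (p * (eta * k.+1%:R - nu) * l).

Lemma level_weight_ge0 k : 0 <= level_weight k.
Proof. by rewrite /level_weight; case: ifP => // _; exact: expR_ge0. Qed.

Lemma measurable_level_set k : measurable (level_set k).
Proof. by rewrite /level_set; case: ifP => // _; exact: measurable_itv. Qed.

(** Take the least [k] with [x < level k.+1]. If [k = 0], then
    [x / n ^ nu <= n ^ (eta - nu) <= 1 / n]. Otherwise the [k]-th indicator is 1, and subadditivity
    of the [p]-th power bounds [(1 + x / n ^ nu) ^ p] by the terms of index 0 and [k]. *)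
Lemma ln1D_level_le (x : R) : 0 <= x -> x < level L.+1 ->
  ln (1 + x / expR (nu * l)) <=
  expR (- l) + p^-1 * ln (\sum_k level_weight k * \1_(level_set k) x).
Proof.
move=> x0 xL; have /andP[p0 p1] := p01.
have ex : exists k, x < level k.+1 by exists L.
case: (ex_minnP ex) => k xk kmin.
have kL : (k < L.+1)%N by rewrite ltnS; exact: kmin.
set G := \sum_k _.
have term0 k' : 0 <= level_weight k' * \1_(level_set k') x.
  by rewrite mulr_ge0// level_weight_ge0.
have lev0 : level_weight ord0 * \1_(level_set ord0) x = 1.
  by rewrite /level_weight /level_set eqxx indicT mulr1.
have G1 : 1 <= G.
  rewrite /G (bigD1 ord0)//= lev0 lerDl.
  by apply: sumr_ge0 => ? _; exact: term0.
have xN y : x < level y -> x / expR (nu * l) <= expR ((eta * y%:R - nu) * l).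
  move=> xy; rewrite mulrBl expRB ler_pM2r ?invr_gt0 ?expR_gt0//.
  exact: ltW.
have xN0 : 0 <= x / expR (nu * l) by rewrite mulr_ge0// invr_ge0 expR_ge0.
have [k0|k0] := posnP k.
  rewrite k0 in xk; apply: (@le_trans _ _ (expR (- l))); last first.
    by rewrite lerDl mulr_ge0 ?invr_ge0 ?(ltW p0)// ln_ge0.
  apply: (le_trans (le_ln1Dx _)); first by apply: lt_le_trans xN0; rewrite ltrN10.
  apply: (le_trans (xN _ xk)); rewrite ler_expR mulr1.
  have := ler_wpM2r l_ge0 nu_ge; lra.
set y := expR ((eta * k.+1%:R - nu) * l).
have Gy : 1 + y `^ p <= G.
  pose kk := Ordinal kL.
  have kk0 : kk != ord0 by rewrite -val_eqE /= -lt0n.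
  rewrite /G (bigD1 ord0)//= lev0 (bigD1 kk)//= addrA -[leLHS]addr0 lerD//.
    rewrite lerD// /level_weight /level_set (negbTE kk0) indicE mem_set ?mulr1/=.
      by rewrite /y -expRM mulrC mulrA.
    rewrite /= in_itv/= andbT leNgt; apply/negP => xlk.
    by have := kmin k.-1; rewrite prednK// => /(_ xlk); lia.
  by apply: sumr_ge0 => ? _; exact: term0.
have y0 : 0 <= y by exact: expR_ge0.
rewrite -[leLHS]add0r lerD ?expR_ge0//.
rewrite ler_pdivlMl// -ln_powR ler_ln ?posrE.
- apply: le_trans Gy; apply: le_trans (powR1D_le y0 p01).
  by rewrite ge0_ler_powR ?nnegrE ?addr_ge0 ?(ltW p0)// lerD2l; exact: xN.
- by rewrite powR_gt0// ltr_pwDl.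
- exact: lt_le_trans G1.
Qed.

(** For [k > 0], weight times tail is [n ^ (p (eta (k + 1) - nu)) * n ^ (- p eta k) = n ^ (p (eta -
    nu))], which no longer depends on [k]. *)
Lemma level_expectation_le (n : nat) (f : set R -> R) :
  f setT <= 1 ->
  (forall k : nat, (0 < k)%N -> f `[level k, +oo[%classic <= expR (- (p * (eta * k%:R * l)))) ->
  L%:R * expR (p * (eta - nu) * l) <= n%:R^-1 ->
  \sum_k level_weight k * f (level_set k) <= 1 + n%:R^-1.
Proof.
move=> f1 flev hL; rewrite big_ord_recl /level_weight /level_set eqxx mul1r lerD//.
apply: le_trans hL.
apply: (@le_trans _ _ (\sum_(k < L) expR (p * (eta - nu) * l))); last first.
  by rewrite sumr_const card_ord -[leLHS]mulr_natl.
apply: ler_sum => k _; rewrite [lift _ _ == _]eq_sym (negbTE (neq_lift _ _)).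
apply: (@le_trans _ _ (expR (p * (eta * (lift ord0 k).+1%:R - nu) * l) *
    expR (- (p * (eta * (lift ord0 k)%:R * l))))).
  by rewrite ler_wpM2l ?expR_ge0// flev.
rewrite -expRD ler_expR -natr1; lra.
Qed.

End Levels.

Section ArrayBounds.
Context d (Omega : measurableType d) (R : realType) (P : probability Omega R).
Context (n : nat) (X : 'I_n * 'I_n -> {RV P >-> R}).
Context (D : {set 'I_n * 'I_n}) (c : 'I_n * 'I_n -> 'I_n * 'I_n).
Hypothesis indep : independent_RVs D X.
Hypothesis cD : forall q, c q \in D.
Hypothesis c_swap : forall q, c q = q \/ c q = (q.2, q.1).
Let l : R := ln n%:R.

(** Two events are excluded: [W >= exp (2 n)], and some entry reaching the top level, which has
    probability at most [n ^ -5] at each of [n ^ 2] positions. Elsewhere [ln1D_level_le] is summed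
    over the positions: the terms [1 / n] give [n], and the logarithms give at most [4 n / p], as
    each independent entry is counted at most twice. *)
Lemma array_permanent_le (p eta nu : R) (L : nat) :
  (0 < n)%N -> 0 < p <= 1 -> 0 < eta -> 1 <= nu - eta -> 5 <= p * eta * L.+1%:R ->
  L%:R * expR (p * (eta - nu) * l) <= n%:R^-1 ->
  (forall q k, (0 < k)%N ->
    (P [set w | (level eta l k <= X q w)%R] <= (expR (- (p * (eta * k%:R * l))))%:E)%E) ->
  exists E, [/\ measurable E, (P E <= (expR (- n%:R) + (n ^ 3)%:R^-1)%:E)%E &
    forall w, ~ E w -> (forall q, 0 < X q w) ->
      ln (permanent (array X c w)) <= n%:R * (nu * l) + n%:R * (1 + 4 / p)].
Proof.
move=> n0 p01 eta0 nu1 etaL hL Xtail; have /andP[p0 p1] := p01.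
have l0 : 0 <= l by rewrite ln_ge0// ler1n.
pose b := level_weight p eta nu l (L := L); pose B := level_set eta l (L := L).
pose W w := \prod_(q in D) \sum_k b k * \1_(X q @^-1` B k) w.
have b0 k : 0 <= b k by exact: level_weight_ge0.
have mB k : measurable (B k) by exact: measurable_level_set.
have preE q t : X q @^-1` `[t, +oo[ = [set w | t <= X q w].
  by apply/seteqP; split => w /=; rewrite in_itv/= andbT.
have [|mW PW] := @probability_prod_ge _ _ _ P n X D indep L b B n0 b0 mB.
  move=> q _; apply: (level_expectation_le (f := fun B => fine (P (X q @^-1` B)))) => //.
    by rewrite preimage_setT probability_setT.
  move=> k k0; rewrite preE -lee_fin fineK ?Xtail// fin_num_measure//.
  exact: measurable_RV_ge.
pose T := \big[setU/set0]_(q : 'I_n * 'I_n) [set w | level eta l L.+1 <= X q w].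
exists ([set w | expR (2 * n%:R) <= W w] `|` T); split.
- by apply: measurableU => //; apply: bigsetU_measurable => q _; exact: measurable_RV_ge.
- have mT : measurable T by apply: bigsetU_measurable => q _; exact: measurable_RV_ge.
  apply: (le_trans (measureU2 _ mW mT)); rewrite EFinD leeD//.
  apply: (@le_trans _ _ (\sum_(q : 'I_n * 'I_n) expR (- (5 * l)))%:E).
    apply: probability_bigsetU_le => [q _|q _]; first exact: measurable_RV_ge.
    apply: (le_trans (Xtail q L.+1 _)) => //; rewrite lee_fin ler_expR lerN2 !mulrA.
    by rewrite ler_wpM2r.
  rewrite lee_fin sumr_const card_prod card_ord -[leLHS]mulr_natl expRN (expRM_natln R 5 n0).
  rewrite ler_pdivrMr ?ltr0n ?expn_gt0 ?n0// [leRHS]mulrC ler_pdivlMr ?ltr0n ?expn_gt0 ?n0//.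
  by rewrite -natrM ler_nat !expnS expn0 muln1 !mulnA.
move=> w nE X0.
have WE : W w < expR (2 * n%:R).
  by rewrite ltNge; apply/negP => h; apply: nE; left.
have Xlt q : X q w < level eta l L.+1.
  rewrite ltNge; apply/negP => h; apply: nE; right.
  by rewrite /T -bigcup_seq; exists q => //=; rewrite mem_index_enum.
have rhs0 : 0 <= n%:R * (nu * l) + n%:R * (1 + 4 / p).
  rewrite addr_ge0// mulr_ge0//; first by rewrite mulr_ge0//; lra.
  by rewrite addr_ge0// mulr_ge0// invr_ge0 ltW.
have M0 i j : 0 <= array X c w i j by rewrite mxE ltW.
(* On a nonpositive argument [ln] is 0 by default, so [rhs0] settles that case. *)
have [per0|per0] := leP (permanent (array X c w)) 0; first by rewrite ln0.
set N := expR (nu * l); have N0 : 0 < N by exact: expR_gt0.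
have f1 q : 1 <= 1 + X q w / N by rewrite lerDl mulr_ge0 ?invr_ge0 ?ltW.
have perle := permanent_le_prod1D N0 M0.
rewrite pair_big /= in perle.
pose G q := \sum_k b k * \1_(B k) (X q w).
have lnprod (J : finType) (Q : pred J) (g : J -> R) : (forall q, Q q -> 0 < g q) ->
    ln (\prod_(q | Q q) g q) = \sum_(q | Q q) ln (g q).
  move=> g0; suff [] : 0 < \prod_(q | Q q) g q /\
    ln (\prod_(q | Q q) g q) = \sum_(q | Q q) ln (g q) by [].
  elim/big_rec2: _ => [|q y s Qq [s0 <-]]; first by rewrite ln1.
  by rewrite lnM ?posrE ?g0// mulr_gt0// g0.
have G1 q : 1 <= G q.
  rewrite /G big_ord_recl /b /B /level_weight /level_set eqxx indicT mul1r lerDl.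
  by apply: sumr_ge0 => k _; rewrite mulr_ge0// (b0 (lift ord0 k)).
have lnW : \sum_(q in D) ln (G q) <= 2 * n%:R.
  rewrite -lnprod; last by move=> q _; apply: lt_le_trans (G1 q).
  rewrite -[leRHS]expRK ler_ln ?posrE ?expR_gt0//; first exact: ltW.
  by apply: prodr_gt0 => q _; apply: lt_le_trans (G1 q).
have step1 : ln (permanent (array X c w)) <=
    n%:R * (nu * l) + \sum_(q : 'I_n * 'I_n) ln (1 + X (c q) w / N).
  rewrite -lnprod; last by move=> q _; apply: lt_le_trans (f1 _).
  rewrite -[n%:R * _]expRK -lnM ?posrE ?expR_gt0//; last first.
    by apply: prodr_gt0 => q _; apply: lt_le_trans (f1 _).
  rewrite ler_ln ?posrE//; last first.
    rewrite mulr_gt0 ?expR_gt0//.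
    by apply: prodr_gt0 => q _; apply: lt_le_trans (f1 _).
  rewrite expRM_natl; apply: (le_trans perle).
  rewrite ler_wpM2l ?exprn_ge0 ?(ltW N0)// le_eqVlt; apply/orP; left; apply/eqP.
  by apply: eq_bigr => -[i j] _; rewrite mxE.
apply: (le_trans step1); rewrite lerD2l.
apply: (@le_trans _ _ (\sum_(q : 'I_n * 'I_n) (expR (- l) + p^-1 * ln (G (c q))))).
  by apply: ler_sum => q _; apply: ln1D_level_le => //; rewrite ltW.
rewrite big_split /= -mulr_sumr sumr_const card_prod card_ord mulrDr lerD//.
  rewrite -[leLHS]mulr_natl expRN lnK ?posrE ?ltr0n// natrM mulrK ?mulr1//.
  by rewrite unitfE pnatr_eq0 -lt0n.
apply: (@le_trans _ _ (p^-1 * (2 * (2 * n%:R)))).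
  rewrite ler_wpM2l ?invr_ge0 ?(ltW p0)//.
  apply: (le_trans (sum_canonical_le (h := fun q => ln (G q)) cD c_swap _)); first by move=> q; rewrite ln_ge0.
  by rewrite ler_wpM2l.
by rewrite (_ : p^-1 * _ = n%:R * (4 / p)); last ring.
Qed.

Lemma array_permanent_ge (K : nat) (t a : R) : 0 <= t -> 0 <= a -> (0 < K <= n)%N ->
  (forall q, (P [set w | (X q w < t)%R] <= (expR (- a))%:E)%E) ->
  exists E, [/\ measurable E,
    (P E <= (\sum_(p | @block_pair n K p) expR (- (a * (#|p.1| * #|p.2|)%:R / 2)))%:E)%E &
    forall w, ~ E w -> (forall q, 0 < X q w) ->
      t ^+ n * ((n - K)`!)%:R <= permanent (array X c w)].
Proof.
move=> t0 a0 Kn Xa; exists (small_block X c K t); split.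
- exact: measurable_small_block.
- by apply: (probability_small_block_le indep cD c_swap K a0) => q _; exact: Xa.
move=> w nE X0; apply: permanent_ge_fact => //.
- by move=> i j; rewrite mxE ltW.
- exact: blocks_meet_array.
Qed.

End ArrayBounds.

(** * Almost sure bounds *)

Section Sequences.
Context d (Omega : measurableType d) (R : realType) (P : probability Omega R).
Context (X : forall n, 'I_n * 'I_n -> {RV P >-> R}).
Context (D : forall n, {set 'I_n * 'I_n}) (c : forall n, 'I_n * 'I_n -> 'I_n * 'I_n).
Hypothesis indep : forall n, independent_RVs (D n) (@X n).
Hypothesis cD : forall n q, c q \in D n.
Hypothesis c_swap : forall n (q : 'I_n * 'I_n), c q = q \/ c q = (q.2, q.1).
Context (F : R -> R).
Hypothesis F_ge0 : forall t, 0 <= F t.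
Hypothesis X_tail : forall n (q : 'I_n * 'I_n) t, P [set w | (t <= X q w)%R] = (F t)%:E.

Let per n w := permanent (array (@X n) (@c n) w).
Let l n : R := ln n%:R.

(** One rank [n] serves all [k] at once, because [n ^ (s k) >= n ^ s] for [k >= 1]. *)
Lemma near_infty_expR_ln (Q : R -> Prop) (s : R) : 0 < s ->
  (\forall t \near +oo, Q t) ->
  \forall n \near \oo, forall k : nat, (0 < k)%N -> Q (expR (s * k%:R * ln n%:R)).
Proof.
move=> s0 [T [_ QT]]; near=> n => k k0; apply: QT.
have lT : `|T| / s <= ln (n%:R : R) by near: n; exact: near_ln_ge.
have l0 : 0 <= ln (n%:R : R) by near: n; exact: near_ln_ge.
rewrite ler_pdivrMr// mulrC in lT.
apply: (lt_le_trans _ (expR_ge1Dx _)); apply: (@le_lt_trans _ _ `|T|); first exact: ler_norm.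
apply: (@lt_le_trans _ _ (1 + s * ln n%:R)); first by lra.
rewrite lerD2l -mulrA ler_wpM2l ?(ltW s0)// -[leLHS]mul1r ler_wpM2r//.
by rewrite ler1n.
Unshelve. all: by end_near. Qed.

Lemma ae_permanent_le (p eta nu : R) : 0 < p <= 1 -> 0 < eta -> 1 <= nu - eta ->
  1 < p * (nu - eta) ->
  (\forall t \near +oo, F t <= expR (- (p * ln t))) ->
  {ae P, forall w, \forall n \near \oo, (forall q, 0 < @X n q w) ->
    ln (per n w) <= n%:R * (nu * l n) + n%:R * (1 + 4 / p)}.
Proof.
move=> p01 eta0 nu1 pnu Ftail; have /andP[p0 p1] := p01.
have pe0 : 0 < p * eta by rewrite mulr_gt0.
(* The number of levels does not depend on [n]; it makes the tail bound at the top level at most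
   [n ^ -5]. *)
pose L := Num.truncn (5 / (p * eta)).
have hL : 5 <= p * eta * L.+1%:R.
  by rewrite mulrC -ler_pdivrMr// ltW// truncnS_gt.
have kap : 0 < p * (nu - eta) - 1 by lra.
apply: Borel_Cantelli_exists; near=> n.
have n0 : (0 < n)%N by near: n; exact: nbhs_infty_gt.
have l1 : 1 <= l n by near: n; exact: near_ln_ge.
have l0 : 0 <= l n by rewrite (le_trans _ l1).
have Fn : forall k, (0 < k)%N -> F (level eta (l n) k) <= expR (- (p * ln (level eta (l n) k))).
  by near: n; exact: (near_infty_expR_ln eta0 Ftail).
(* The exponent [p (nu - eta) - 1] is positive, so this power of [n] absorbs the constant [L]. *)
have Ln : L%:R * expR (p * (eta - nu) * l n) <= n%:R^-1.
  have : L%:R * l n <= expR ((p * (nu - eta) - 1) * l n).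
    by near: n; exact: near_linear_le_expR.
  have nE : n%:R^-1 = expR (- l n) by rewrite expRN lnK ?posrE ?ltr0n.
  move=> h; rewrite nE -ler_pdivlMr ?expR_gt0// -expRB.
  rewrite (_ : - l n - _ = (p * (nu - eta) - 1) * l n); last by ring.
  by apply: le_trans h; rewrite ler_peMr.
have [|E [mE PE hE]] := array_permanent_le (@indep n) (@cD n) (@c_swap n) n0 p01 eta0 nu1 hL Ln.
  by move=> q k k0; rewrite X_tail lee_fin (le_trans (Fn _ k0))// /level expRK mulrA.
exists E; split => //; apply: (le_trans PE); rewrite lee_fin.
by near: n; exact: near_expRN_cube_le.
Unshelve. all: by end_near. Qed.

Lemma RV_lt_le_expRN n (q : 'I_n * 'I_n) t :
  (P [set w | (X q w < t)%R] <= (expR (- F t))%:E)%E.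
Proof.
have -> : [set w | X q w < t] = ~` [set w | t <= X q w].
  by apply/seteqP; split => w /=; rewrite ltNge => /negP.
rewrite probability_setC; last exact: measurable_RV_ge.
by rewrite X_tail -EFinB lee_fin expR_ge1Dx.
Qed.

(** Take [t = n ^ s] and [K = n], so that the factorial is [0! = 1]. Then [n F(t) >= n ^ (1 - q s)]
    eventually exceeds [40 ln n]; with the 8 of [sum_full_block_pairs_le], this gives
    [z <= n ^ -5]. *)
Lemma ae_permanent_ge_heavy (s q : R) : 0 < s -> q * s < 1 ->
  (\forall t \near +oo, expR (- (q * ln t)) <= F t) ->
  {ae P, forall w, \forall n \near \oo, (forall q, 0 < @X n q w) ->
    n%:R * (s * l n) <= ln (per n w)}.
Proof.
move=> s0 qs Ftail; have Fnear := near_infty_expR_ln s0 Ftail.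
have Fl0 := @near_linear_le_expR R (1 - q * s) 40 ltac:(lra).
apply: Borel_Cantelli_exists; near=> n.
have n4 : (4 < n)%N by near: n; exact: nbhs_infty_gt.
have n0 : (0 < n)%N by lia.
have Fl : 40 * l n <= expR ((1 - q * s) * l n) by near: n.
have Fn : forall k, (0 < k)%N ->
    expR (- (q * ln (expR (s * k%:R * ln n%:R)))) <= F (expR (s * k%:R * ln n%:R)).
  by near: n.
have {Fn} := Fn 1%N erefl; rewrite mulr1 expRK -/(l n); set t := expR (s * l n) => Ft.
have nE : n%:R = expR (l n) by rewrite lnK ?posrE ?ltr0n.
have zn : expR (- (F t * n%:R / 8)) <= expR (- (5 * l n)).
  rewrite ler_expR lerN2 ler_pdivlMr//; apply: (@le_trans _ _ (40 * l n)); first by lra.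
  apply: (le_trans Fl); rewrite mulrBl mul1r expRB -nE mulrC ler_wpM2r//.
  by rewrite -expRN mulrA in Ft *.
have [||||E [mE PE hE]] := @array_permanent_ge _ _ _ P n (@X n) (D n) (@c n) (@indep n) (@cD n) (@c_swap n) n t (F t).
- exact: expR_ge0.
- exact: F_ge0.
- by rewrite n0 leqnn.
- by move=> q'; exact: RV_lt_le_expRN.
exists E; split => //.
  apply: (le_trans PE); rewrite lee_fin; apply: (le_trans (sum_full_block_pairs_le _ (F_ge0 t))).
  by apply: full_block_sum_le => //; exact: expR_ge0.
move=> w nE' X0; have := hE w nE' X0; rewrite subnn mulr1 => h.
rewrite -[leLHS]expRK ler_ln ?posrE ?expR_gt0 ?expRM_natl//.
by apply: lt_le_trans h; rewrite exprn_gt0// expR_gt0.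
Unshelve. all: by end_near. Qed.

(** With [K] about [n / r], the permanent is at least [t ^ n * (n - K)! >= t ^ n * K ^ (n - 2 K)],
    whose logarithm loses only a fraction of order [1 / r] of [n ln n]. *)
Lemma ae_permanent_ge_dense (e : R) : 0 < e ->
  (forall a : R, exists2 t : R, 0 < t & forall n (q : 'I_n * 'I_n),
     (P [set w | (X q w < t)%R] <= (expR (- a))%:E)%E) ->
  {ae P, forall w, \forall n \near \oo, (forall q, 0 < @X n q w) ->
    n%:R * ((1 - e) * l n) <= ln (per n w)}.
Proof.
(* The term [4 / e] controls the loss; the added 4 ensures [2 K <= n] for [n >= 8]. *)
move=> e0 small; pose r := (Num.truncn (4 / e) + 4)%N.
have r4 : (4 <= r)%N by rewrite leq_addl.
have r0 : (0 < r)%N by lia.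
have rr0 : 0 < r%:R :> R by rewrite ltr0n.
have re : 4 <= e * r%:R.
  rewrite mulrC -ler_pdivrMr//; apply: ltW; apply: lt_le_trans (truncnS_gt _) _.
  by rewrite ler_nat -addn1 leq_add2l.
have [t t0 Xt] := small (6 * r%:R).
have sum_near := near_block_sum R r0.
apply: Borel_Cantelli_exists; near=> n.
have n8 : (8 <= n)%N by near: n; exact: nbhs_infty_ge.
have n0 : (0 < n)%N by lia.
pose K := (n %/ r).+1.
have rK : n%:R <= r%:R * K%:R :> R.
  by rewrite -natrM ler_nat mulnC mulSn addnC {1}(divn_eq n r) leq_add2l ltnW// ltn_pmod.
have Kr : K%:R <= n%:R / r%:R + 1 :> R.
  by rewrite -natr1 lerD2r ler_pdivlMr// -natrM ler_nat leq_trunc_div.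
have K2 : (K + K <= n)%N.
  have : (n %/ r <= n %/ 4)%N by exact: leq_div2l.
  have := leq_trunc_div n 4; rewrite /K.
  by move: (n %/ r)%N (n %/ 4)%N => x y; lia.
have [|||E [mE PE hE]] := @array_permanent_ge _ _ _ P n (@X n) (D n) (@c n) (@indep n) (@cD n) (@c_swap n) K t (6 * r%:R) (ltW t0).
- by rewrite mulr_ge0.
- by rewrite /=; lia.
- exact: Xt.
exists E; split => //.
  apply: (le_trans PE); rewrite lee_fin.
  apply: (le_trans (sum_block_pairs_le _ _ _)); first by rewrite mulr_ge0.
  by rewrite /K; near: n.
move=> w nE' X0; have h := hE w nE' X0.
have tn0 : 0 < t ^+ n by rewrite exprn_gt0.
have K0 : 0 < K%:R :> R by rewrite ltr0n.
have fact0 : 0 < ((n - K)`!)%:R :> R by rewrite ltr0n fact_gt0.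
have hK2 : (K <= n)%N := leq_trans (leq_addr _ _) K2.
have hK1 : (K <= n - K)%N by rewrite leq_subRL.
have nKE : (n - K - K)%:R = n%:R - K%:R - K%:R :> R.
  by rewrite (natrB R hK1) (natrB R hK2).
have lnper : n%:R * ln t + (n%:R - K%:R - K%:R) * ln K%:R <= ln (per n w).
  apply: (@le_trans _ _ (ln (t ^+ n * ((n - K)`!)%:R))).
    rewrite lnM ?posrE// lnXn// -[ln t *+ n]mulr_natl lerD2l.
    rewrite -nKE.
    rewrite mulr_natl -lnXn// ler_ln ?posrE ?exprn_gt0// -natrX ler_nat.
    exact: fact_ge_exp.
  by rewrite ler_ln ?posrE ?mulr_gt0//; apply: lt_le_trans h; rewrite mulr_gt0.
apply: le_trans lnper.
have ln0 : 0 <= l n by near: n; exact: near_ln_ge.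
have lr0 : 0 <= ln (r%:R : R) by rewrite ln_ge0// ler1n.
have lK : l n - ln r%:R <= ln K%:R.
  by rewrite lerBlDl -lnM ?posrE ?ltr0n// ler_ln ?posrE ?ltr0n// mulr_gt0.
have lbig : (4 / e) * (ln r%:R + `|ln t|) <= l n by near: n; exact: near_ln_ge.
have nbig : 8 / e <= n%:R by near: n; exact: nbhs_infty_ger.
have nK : 0 <= n%:R - K%:R - K%:R :> R.
  by rewrite -nKE.
apply: (@le_trans _ _ (n%:R * ln t + (n%:R - K%:R - K%:R) * (l n - ln r%:R))); last first.
  by rewrite lerD2l ler_wpM2l.
have tabs : - `|ln t| <= ln t by rewrite lerNl ler_normr lexx orbT.
have nr : n%:R / r%:R <= e / 4 * n%:R.
  rewrite ler_pdivrMr//; have := ler_wpM2r (ler0n R n) re; lra.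
(* The allowed loss [e n ln n] is shared out: a quarter for [ln r] and [ln t], a half for the main
   part of [2 K ln n], and a quarter for its remainder [2 ln n]. *)
have h1 : n%:R * (ln r%:R + `|ln t|) <= e / 4 * (n%:R * l n).
  rewrite mulrCA ler_wpM2l//.
  by rewrite -ler_pdivrMl ?divr_gt0// invf_div.
have h2 : 2 * l n <= e / 4 * (n%:R * l n).
  rewrite mulrA ler_wpM2r//.
  by rewrite ler_pdivrMr// in nbig; lra.
have h3 : K%:R * l n <= (e / 4 * n%:R + 1) * l n by rewrite ler_wpM2r//; lra.
have h4 : n%:R * - `|ln t| <= n%:R * ln t by rewrite ler_wpM2l.
have h5 : 0 <= K%:R * ln r%:R :> R by rewrite mulr_ge0.
lra.
Unshelve. all: by end_near. Qed.

End Sequences.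

(** * From almost sure bounds to the limit *)

(** Continuity from above: the events [Y < 1 / (k + 1)] decrease to the null event [Y <= 0]. *)
Lemma probability_lt_small d (Omega : measurableType d) (R : realType)
    (P : probability Omega R) (Y : {RV P >-> R}) (e : R) :
  as_positive Y -> 0 < e -> exists2 t : R, 0 < t & (P [set w | (Y w < t)%R] <= e%:E)%E.
Proof.
move=> Ypos e0; pose E (k : nat) := [set w | Y w < k.+1%:R^-1].
have mY t : measurable [set w | Y w < t].
  exact: measurable_RV_lt.
have capE : \bigcap_k E k = [set w | Y w <= 0].
  apply/seteqP; split => w /= h; last first.
    by move=> k _; rewrite /E/= (le_lt_trans h)// invr_gt0.
  rewrite leNgt; apply/negP => Y0.
  have := h (Num.truncn (Y w)^-1) I; rewrite /E/= ltNge => /negP; apply.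
  rewrite invf_ple ?posrE//; exact/ltW/truncnS_gt.
have mcap : measurable (\bigcap_k E k) by apply: bigcap_measurable => // k _; exact: mY.
have cap0 : P (\bigcap_k E k) = 0%E.
  apply/negligibleP => //; rewrite capE; apply: negligibleS Ypos => w /= h.
  by apply/negP; rewrite -leNgt.
have : P \o E @ \oo --> P (\bigcap_k E k).
  apply: nonincreasing_cvg_mu => //.
- by rewrite ltey_eq fin_num_measure//; exact: mY.
- by move=> i; exact: mY.
  move=> m k mk; apply/subsetPset => w; rewrite /E/= => /lt_le_trans; apply.
  by rewrite lef_pV2 ?posrE// ler_nat.
rewrite cap0 => /fine_cvgP[_].
move=> /cvgr_lt/(_ _ e0)[k _ /(_ k (leqnn k))] /= Pk.
exists k.+1%:R^-1; first by rewrite invr_gt0.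
have fE : P (E k) = (fine (P (E k)))%:E.
  by rewrite fineK// fin_num_measure//; exact: mY.
by rewrite -/(E k) fE lee_fin ltW.
Qed.

(** Only the countably many errors [1 / (k + 1)] occur, so that bounds holding almost surely for
    each error hold almost surely for all of them together. *)
Lemma cvg_of_near_bounds (R : realType) (u v : nat -> R) (g : R) :
  (\forall n \near \oo, 0 < v n) ->
  (forall k : nat, \forall n \near \oo,
     v n * (g - k.+1%:R^-1) <= u n <= v n * (g + k.+1%:R^-1)) ->
  u n / v n @[n --> \oo] --> g.
Proof.
move=> v0 uv; apply/cvgrPdist_le => e e0.
pose k := Num.truncn e^-1.
have ke : k.+1%:R^-1 <= e by rewrite invf_ple ?posrE//; exact/ltW/truncnS_gt.
have uvk := uv k.
near=> n.
have vn : 0 < v n by near: n.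
have : v n * (g - k.+1%:R^-1) <= u n <= v n * (g + k.+1%:R^-1) by near: n.
move=> /andP[]; rewrite mulrC -ler_pdivlMr// => h1; rewrite mulrC -ler_pdivrMr// => h2.
rewrite ler_norml lerNl opprB lerBlDr; apply/andP; split.
  by apply: le_trans h2 _; rewrite addrC lerD2r.
rewrite lerBlDr in h1; rewrite lerBlDr; apply: (le_trans h1).
by rewrite addrC lerD2r.
Unshelve. all: by end_near. Qed.

Section CanonicalArrays.
Context (R : realType).
Context d (Omega : measurableType d) (P : probability Omega R).
Context d' (Omega' : measurableType d') (P' : probability Omega' R).
Context (A : forall n : nat, 'M[{RV P >-> R}]_n) (xi : {RV P' >-> R}) (beta : R).
Context (D : forall n, {set 'I_n * 'I_n}) (c : forall n, 'I_n * 'I_n -> 'I_n * 'I_n).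
Let X n (q : 'I_n * 'I_n) := A n q.1 q.2.
Hypothesis A_gt0 : forall (n : nat) (i j : 'I_n), as_positive (A n i j).
Hypothesis A_id : forall (n : nat) (i j : 'I_n), identically_distributed (A n i j) xi.
Hypothesis indep : forall n, independent_RVs (D n) (@X n).
Hypothesis cD : forall n q, c q \in D n.
Hypothesis c_swap : forall n (q : 'I_n * 'I_n), c q = q \/ c q = (q.2, q.1).
Hypothesis canonicalE : forall n (q : 'I_n * 'I_n), {ae P, forall w, X (c q) w = X q w}.
Hypothesis beta_gt0 : 0 < beta.
Hypothesis xi_tail :
  ln (fine (P' [set w | t <= xi w])) / ln t @[t --> +oo] --> - beta^-1.

Lemma ae_finite (I : finType) (Q : I -> Omega -> Prop) :
  (forall i, {ae P, forall w, Q i w}) -> {ae P, forall w, forall i, Q i w}.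
Proof.
move=> h; have : {ae P, forall w, forall i, i \in index_enum I -> Q i w}.
  elim: (index_enum I) => [|i s IH]; first by apply: aeW => w i; rewrite in_nil.
  apply: filterS2 (h i) IH => w Qi Qs j; rewrite in_cons => /predU1P[->//|]; exact: Qs.
by apply: filterS => w Qw i; apply: Qw; rewrite mem_index_enum.
Qed.

Let F t : R := fine (P' [set w | t <= xi w]).

Let F_ge0 t : 0 <= F t.
Proof. exact: fine_ge0. Qed.

Let X_tail n (q : 'I_n * 'I_n) t : P [set w | (t <= X q w)%R] = (F t)%:E.
Proof.
rewrite /F fineK; last first.
  apply: fin_num_measure.
  exact: measurable_RV_ge.
have := A_id q.1 q.2 (measurable_itv `[t, +oo[).
rewrite /distribution /pushforward.
have pre (T : Type) (Y : T -> R) : Y @^-1` `[t, +oo[ = [set w | t <= Y w].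
  by apply/seteqP; split => w /=; rewrite in_itv/= andbT.
by rewrite !pre.
Qed.

Let X_small (a : R) : exists2 t : R, 0 < t & forall n (q : 'I_n * 'I_n),
  (P [set w | (X q w < t)%R] <= (expR (- a))%:E)%E.
Proof.
(* All entries share one law, so a threshold found for the single entry of [A 1] serves every
   position in every size. *)
have [t t0 Pt] := @probability_lt_small _ _ _ P (A 1%N ord0 ord0) _ (@A_gt0 1%N ord0 ord0) (expR_gt0 (- a)).
exists t => // n q; apply: le_trans Pt.
have compl m (r : 'I_m * 'I_m) : P [set w | (X r w < t)%R] = (1 - (F t)%:E)%E.
  have -> : [set w | X r w < t] = ~` [set w | t <= X r w].
    by apply/seteqP; split => w /=; rewrite ltNge => /negP.
  by rewrite probability_setC ?X_tail//; exact: measurable_RV_ge.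
by rewrite compl -(compl 1%N (ord0, ord0)).
Qed.

Let g : R := Num.max 1 beta.

Lemma ae_permanent_limit : {ae P, forall w,
  ln (permanent (realization (A n) w)) / (n%:R * ln n%:R) @[n --> \oo] --> g}.
Proof.
have g1 : 1 <= g by rewrite le_max lexx.
have gb : beta <= g by rewrite le_max lexx orbT.
have pos : {ae P, forall w, forall n (q : 'I_n * 'I_n), 0 < X q w}.
  by apply: ae_foralln => n; apply: ae_finite => q; exact: A_gt0.
have can : {ae P, forall w, forall n (q : 'I_n * 'I_n), X (c q) w = X q w}.
  by apply: ae_foralln => n; apply: ae_finite => q; exact: canonicalE.
have upper : {ae P, forall w, forall k : nat, \forall n \near \oo, (forall q, 0 < @X n q w) ->
    ln (permanent (array (@X n) (@c n) w)) <= (n%:R * ln n%:R) * (g + k.+1%:R^-1)}.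
  apply: ae_foralln => k; set e : R := k.+1%:R^-1.
  have e0 : 0 < e by rewrite invr_gt0.
  (* This [p] is at most 1 and below [1 / beta]. With [nu = g + e / 2] and [eta = e / 8],
     [nu - eta = g + 3 e / 8] exceeds [1 / p]; the remaining [e / 2] absorbs the linear term
     [n (1 + 4 / p)]. *)
  pose p := (g + e / 4)^-1.
  have p0 : 0 < p by rewrite invr_gt0; lra.
  have pe : p * (g + e / 4) = 1 by rewrite mulVf// gt_eqF//; lra.
  have p01 : 0 < p <= 1 by rewrite p0 invf_le1; lra.
  have pe0 : 0 < p * e by rewrite mulr_gt0.
  have nu1 : 1 <= (g + e / 2) - e / 8 by lra.
  have pnu : 1 < p * ((g + e / 2) - e / 8) by lra.
  have pb : p < beta^-1 by rewrite ltf_pV2 ?posrE//; lra.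
  have := ae_permanent_le indep cD c_swap X_tail p01 (_ : 0 < e / 8) nu1 pnu
    (tail_le F_ge0 pb xi_tail).
  move=> /(_ (divr_gt0 e0 (ltr0n _ 8))); apply: filterS => w.
  apply: filterS2 (near_ln_ge ((1 + 4 / p) * (2 / e))) => n lbig h q0.
  apply: (le_trans (h q0)); rewrite -mulrDr -mulrA ler_wpM2l//.
  move: lbig; rewrite mulrA ler_pdivrMr//; lra.
have lower1 : {ae P, forall w, forall k : nat, \forall n \near \oo, (forall q, 0 < @X n q w) ->
    (n%:R * ln n%:R) * (1 - k.+1%:R^-1) <= ln (permanent (array (@X n) (@c n) w))}.
  apply: ae_foralln => k; set e : R := k.+1%:R^-1.
  have e0 : 0 < e by rewrite invr_gt0.
  have := ae_permanent_ge_dense indep cD c_swap e0 X_small.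
  apply: filterS => w; apply: filterS => n h q0; apply: le_trans (h q0).
  by rewrite -mulrA [_ * (1 - e)]mulrC.
have lowerb : {ae P, forall w, forall k : nat, \forall n \near \oo, (forall q, 0 < @X n q w) ->
    (n%:R * ln n%:R) * (beta - k.+1%:R^-1) <= ln (permanent (array (@X n) (@c n) w))}.
  apply: ae_foralln => k; set e : R := k.+1%:R^-1.
  have e0 : 0 < e by rewrite invr_gt0.
  (* The maximum keeps [s] positive even when [e >= beta]; the midpoint [q] below then satisfies
     [1 / beta < q < 1 / s]. *)
  pose s := Num.max (beta - e) (beta / 2).
  have s0 : 0 < s by rewrite lt_max divr_gt0 ?orbT.
  have sb : s < beta by rewrite gt_max ltrBlDr ltrDl e0 ltr_pdivrMr// ltr_pMr// ltr1n.
  have sV : beta^-1 < s^-1 by rewrite ltf_pV2 ?posrE.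
  pose q := (beta^-1 + s^-1) / 2.
  have qs : q * s < 1 by rewrite -ltr_pdivlMr// div1r midf_lt.
  have bq : beta^-1 < q by rewrite midf_lt.
  have b0 : 0 < beta^-1 by rewrite invr_gt0.
  have := ae_permanent_ge_heavy indep cD c_swap F_ge0 X_tail s0 qs
    (tail_ge F_ge0 b0 bq xi_tail).
  apply: filterS => w; apply: filterS2 (near_ln_ge 0) => n l0 h q0.
  apply: le_trans (h q0); rewrite -mulrA ler_wpM2l// mulrC ler_wpM2r ?le_max ?lexx//.
  exact: l0.
apply: (filter_app _ _ lowerb); apply: (filter_app _ _ lower1).
apply: (filter_app _ _ upper); apply: filterS2 pos can => w posw canw up lo1 lob.
apply: cvg_of_near_bounds => [|k].
  near=> n; have n1 : (1 < n)%N by near: n; exact: nbhs_infty_gt.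
  by rewrite mulr_gt0 ?ltr0n ?ln_gt0 ?ltr1n// ltnW.
have upk := up k; have lo1k := lo1 k; have lobk := lob k.
near=> n.
have -> : realization (A n) w = array (@X n) (@c n) w.
  by apply/matrixP => i j; rewrite !mxE canw.
have q0 := posw n; apply/andP; split; last by move: q0; near: n.
rewrite /g; case: (leP 1 beta) => _; first by move: q0; near: n.
by move: q0; near: n.
Unshelve. all: by end_near. Qed.

End CanonicalArrays.

Theorem theorem1 (R : realType)
  (d : measure_display) (Omega : measurableType d) (P : probability Omega R)
  (d' : measure_display) (Omega' : measurableType d') (P' : probability Omega' R)
  (A : forall n : nat, 'M[{RV P >-> R}]_n) (xi : {RV P' >-> R}) (beta : R)
  (A_gt0 : forall (n : nat) (i j : 'I_n), as_positive (A n i j))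
  (A_id : forall (n : nat) (i j : 'I_n), identically_distributed (A n i j) xi)
  (A_indep :
    (forall n : nat, independent_entries (A n)) \/
    (forall n : nat, as_symmetric (A n) /\ independent_upper_entries (A n)))
  (beta_gt0 : 0 < beta)
  (xi_tail :
    ln (fine (P' [set w | t <= xi w])) / ln t @[t --> +oo] --> - beta^-1) :
  {ae P, forall w,
    ln (permanent (realization (A n) w)) / (n%:R * ln n%:R) @[n --> \oo]
      --> Num.max 1 beta}.
Proof.
case: A_indep => [indep|sym_indep].
  apply: (ae_permanent_limit (D := fun=> [set: _]%SET) (c := fun _ q => q) A_gt0 A_id) => //.
  - by move=> n q; rewrite inE.
  - by move=> n q; left.
  - by move=> n q; apply: aeW.
(* Case II: positions are folded onto the upper triangle, and almost sure symmetry identifies the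
   folded matrix with the given one. *)
pose c n (q : 'I_n * 'I_n) := if (q.1 <= q.2)%N then q else (q.2, q.1).
apply: (ae_permanent_limit (D := fun n => [set p : 'I_n * 'I_n | (p.1 <= p.2)%N]%SET)
  (c := c) A_gt0 A_id) => //.
- by move=> n; exact: (sym_indep n).2.
- by move=> n q; rewrite inE /c; case: ifPn => //=; rewrite -ltnNge => /ltnW.
- by move=> n q; rewrite /c; case: ifP => _; [left|right].
- move=> n q; rewrite /c; case: ifP => _; first exact: aeW.
  exact: (sym_indep n).1.
Qed.
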